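(* There is an absolute constant $c>0$ such that for every instance $I$ of continuous BGT with $n\ge2$ and growth rates normalized so that $\sum_i h_i=1$, the schedule produced by Algorithm 3 satisfies $\mathrm{MH}\le c\cdot\log_2 n\cdot\mathrm{OPT}(I)$. Algorithm 3: let $s=\lceil 2\log_2 n\rceil$, $V_0=\{v_j: h_j\le n^{-2}\}$, enumerated as $v'_0,\dots,v'_{\ell-1}$, and for $i=1,\dots,s$, $V_i=\{v_j: 2^{i-1}n^{-2}<h_j\le 2^i n^{-2}\}$. For each nonempty $V_i$ ($i\ge1$) compute a minimum spanning tree $T_i$ of $V_i$ and a directed closed Euler tour $C_i$ of $T_i$ (a cyclic walk traversing each edge twice), marking an arbitrary point of $C_i$ as its ''last visited point''. Set $j=0$. The robot starts at $v_1$ and repeats forever: (a) for $i=1,\dots,s$ with $V_i\ne\emptyset$: travel directly to the last visited point of $C_i$; then, if $|V_i|\ge2$, walk along $C_i$ in the tour direction, stopping at the first tour vertex at which the distance covered along $C_i$ in this phase is at least $D$, and make it the new last visited point of $C_i$; (b) if $V_0\ne\emptyset$, travel directly to $v'_j$ and set $j\leftarrow (j+1)\bmod \ell$. Bamboos are cut whenever the robot is at their point.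
   Context: Continuous BGT: bamboos at points $V=\{v_1,\dots,v_n\}$, growth rates $h_1\ge\dots\ge h_n>0$, initial heights $0$; symmetric travel times $t_{i,j}>0$ ($i\ne j$) satisfying the triangle inequality. The robot starts at $v_1$ at time $0$, moving from $v_i$ to $v_j$ takes time $t_{i,j}$, and the bamboo at a point is cut instantaneously to $0$ whenever the robot is there. Height of $b_i$ at time $t$ = $h_i$ times time since its last cut (or since $0$). $\mathrm{MH}$ = supremum of all heights over all times; $\mathrm{OPT}(I)$ = infimum of $\mathrm{MH}$ over all robot walks. $D=\max_{i,j}t_{i,j}$. *)

(* Defs.v *)
From HB Require Import structures.
From mathcomp Require Import all_boot all_order all_algebra.
From mathcomp Require Import all_classical all_reals.
From mathcomp Require Import ereal exp.
From mathcomp Require Import Rstruct.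
Set Implicit Arguments. Unset Strict Implicit. Unset Printing Implicit Defensive.
Import Order.TTheory GRing.Theory Num.Theory.
Local Open Scope ring_scope.

Notation R := Rdefinitions.R.

Section BGT.
Variable n : nat.

Definition v1_of (Hn : (1 < n)%N) : 'I_n := Ordinal (ltnW Hn).

(** Travel times: [t] is only meaningful off the diagonal; staying at a
    point takes time 0. *)
Definition tt (t : 'I_n -> 'I_n -> R) (i j : 'I_n) : R :=
  if i == j then 0 else t i j.

Definition Dmax (t : 'I_n -> 'I_n -> R) : R :=
  \big[Order.max/0]_(i : 'I_n) \big[Order.max/0]_(j : 'I_n) tt t i j.

(** Robot walks.  The robot visits the points [wp 0], [wp 1], ...; it
    arrives at [wp k] at time [warr k], stays there until time [wdep k]
    (waiting is allowed), then travels directly to [wp (k+1)]. *)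
Record walk := Walk {
  wp : nat -> 'I_n;
  warr : nat -> R;
  wdep : nat -> R }.

Definition valid_walk (t : 'I_n -> 'I_n -> R) (v1 : 'I_n) (w : walk) : Prop :=
  [/\ wp w 0 = v1, warr w 0 = 0,
      (forall k, warr w k <= wdep w k),
      (forall k, warr w k.+1 = wdep w k + tt t (wp w k) (wp w k.+1))
    & (forall T : R, exists k, T <= warr w k)].

Definition at_point (w : walk) (i : 'I_n) (s : R) : Prop :=
  exists k, wp w k = i /\ warr w k <= s <= wdep w k.

Definition lastcut (w : walk) (i : 'I_n) (tau : R) : R :=
  sup [set s : R | 0 <= s <= tau /\ (s = 0 \/ at_point w i s)].

Definition height (h : 'I_n -> R) (w : walk) (i : 'I_n) (tau : R) : R :=
  h i * (tau - lastcut w i tau).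

Definition MH (h : 'I_n -> R) (w : walk) : \bar R :=
  ereal_sup [set x : \bar R | exists i tau, 0 <= tau /\ x = (height h w i tau)%:E].

Definition OPT (h : 'I_n -> R) (t : 'I_n -> 'I_n -> R) (v1 : 'I_n) : \bar R :=
  ereal_inf [set MH h w | w in valid_walk t v1].

(** s = ceil (2 log_2 n) = least s with n^2 <= 2^s. *)
Definition snum : nat := up_log 2 (n ^ 2).

Definition inV (h : 'I_n -> R) (i : nat) (j : 'I_n) : bool :=
  if i == 0%N then h j <= (n%:R ^+ 2)^-1
  else (2%:R ^+ i.-1 / n%:R ^+ 2 < h j) && (h j <= 2%:R ^+ i / n%:R ^+ 2).

Definition Vset (h : 'I_n -> R) (i : nat) : {set 'I_n} := [set j | inV h i j].

Definition erel (E : seq ('I_n * 'I_n)) : rel 'I_n :=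
  fun x y => ((x, y) \in E) || ((y, x) \in E).

Definition is_spanning_tree (S : {set 'I_n}) (E : seq ('I_n * 'I_n)) : Prop :=
  [/\ size E = #|S|.-1,
      all (fun e => [&& e.1 \in S, e.2 \in S & e.1 != e.2]) E
    & forall x y, x \in S -> y \in S -> connect (erel E) x y].

Definition tree_weight (t : 'I_n -> 'I_n -> R) (E : seq ('I_n * 'I_n)) : R :=
  \sum_(e <- E) tt t e.1 e.2.

Definition is_mst (t : 'I_n -> 'I_n -> R) (S : {set 'I_n}) (E : seq ('I_n * 'I_n)) : Prop :=
  is_spanning_tree S E /\
  forall E', is_spanning_tree S E' -> tree_weight t E <= tree_weight t E'.

(** Directed closed Euler tour of the tree E on S, as a cyclic sequence of
    vertices c_0, ..., c_{m-1} (c_m = c_0): every arc (u,v) with {u,v} a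
    tree edge is traversed exactly once, no other arc is traversed (so each
    tree edge is traversed twice).  For |S| <= 1 the tour is trivial. *)
Definition is_euler_tour (v1 : 'I_n) (S : {set 'I_n}) (E : seq ('I_n * 'I_n))
    (c : seq 'I_n) : Prop :=
  if (2 <= #|S|)%N then
    forall u v,
      count (fun k => (nth v1 c k == u) && (nth v1 c ((k.+1) %% size c) == v))
            (iota 0 (size c)) = erel E u v
  else c = enum S.

Section Alg.
Variables (h : 'I_n -> R) (t : 'I_n -> 'I_n -> R) (v1 : 'I_n).
Variables (e : seq 'I_n) (C : nat -> seq 'I_n) (m0 : nat -> nat).

Definition cum (c : seq 'I_n) (m K : nat) : R :=
  \sum_(r < K) tt t (nth v1 c ((m + r) %% size c)) (nth v1 c ((m + r).+1 %% size c)).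

Definition stopk (c : seq 'I_n) (m : nat) : nat :=
  match pselect (exists K, Dmax t <= cum c m K) with
  | left H => ex_minn (P := fun K => Dmax t <= cum c m K) H
  | right _ => 0%N
  end.

Definition phase (c : seq 'I_n) (m : nat) : seq 'I_n * nat :=
  if c is [::] then ([::], m)
  else if (size c < 2)%N then ([:: nth v1 c m], m)
  else let K := stopk c m in
       ([seq nth v1 c ((m + r) %% size c) | r <- iota 0 K.+1], ((m + K) %% size c)%N).

(** state: last visited positions of the tours, and the counter j *)
Definition state := ((nat -> nat) * nat)%type.

Definition round (st : state) : seq 'I_n * state :=
  let '(l, mk) :=
    foldl (fun acc i =>
             let '(l, mk) := acc in
             let '(l', m') := phase (C i) (mk i) in
             (l ++ l', fun x => if x == i then m' else mk x))
          ([::], st.1) (iota 1 snum) in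
  if e is [::] then (l, (mk, st.2))
  else (rcons l (nth v1 e st.2), (mk, (st.2.+1 %% size e)%N)).

Definition alg_state (k : nat) : state := iter k (fun st => (round st).2) (m0, 0%N).

Definition alg_round (k : nat) : seq 'I_n := (round (alg_state k)).1.

Definition alg_point (N : nat) : 'I_n :=
  nth v1 (v1 :: flatten (mkseq alg_round N.+1)) N.

Fixpoint alg_time (N : nat) : R :=
  if N is N'.+1 then alg_time N' + tt t (alg_point N') (alg_point N) else 0.

Definition alg_walk : walk := Walk alg_point alg_time alg_time.

End Alg.
End BGT.

(* Main.v *)
(** Every walk that keeps all heights below [M] satisfies two bounds.  When it
    first reaches a point [v_j], bamboo [1] has not been cut for at least
    [t_{1,j}], and [D <= 2 max_j t_{1,j}], so [h_1 D <= 2 M].  A bamboo of rate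
    above [r] is first cut by time [M / r], so shortcutting an initial part of
    the walk gives a spanning tree of [V_i] of weight at most [M / r] for
    [r = 2^(i-1) / n^2].

    A round of the algorithm takes time at most [(3 s + 1) D] and advances by at
    least [D] along every tour, so a bamboo of [V_i] is cut in any [G] consecutive
    rounds once [G D] exceeds the length of [C_i], which is at most twice the
    weight of [T_i]; a bamboo of [V_0] is cut in any [n] consecutive rounds.
    Multiplying by the rate (at most [2 r] in [V_i], at most [h_1 / n] in [V_0])
    bounds all heights by [8 (3 s + 1) M], and [3 s + 1 <= 10 log_2 n]. *)

Require Import Defs.
From HB Require Import structures.
From mathcomp Require Import all_boot all_order all_algebra.
From mathcomp Require Import all_classical all_reals.
From mathcomp Require Import ereal exp.
From mathcomp Require Import Rstruct.
From mathcomp Require Import zify lra.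
Import Order.TTheory GRing.Theory Num.Theory.
Local Open Scope ring_scope.

Set Implicit Arguments.
Unset Strict Implicit.
Unset Printing Implicit Defensive.

(** * Walks in the metric space of the bamboos *)

Section Metric.

Variables (n : nat) (t : 'I_n -> 'I_n -> R).
Hypothesis t_gt0 : forall i j, i != j -> 0 < t i j.
Hypothesis t_sym : forall i j, i != j -> t i j = t j i.
Hypothesis t_tri : forall i j k,
  i != j -> i != k -> j != k -> t i j <= t i k + t k j.

Lemma tt_xx i : tt t i i = 0.
Proof. by rewrite /tt eqxx. Qed.

Lemma tt_gt0 i j : i != j -> 0 < tt t i j.
Proof. by rewrite /tt => ij; rewrite (negbTE ij) t_gt0. Qed.

Lemma tt_ge0 i j : 0 <= tt t i j.
Proof. by have [->|/tt_gt0/ltW//] := eqVneq i j; rewrite tt_xx. Qed.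

Lemma tt_sym i j : tt t i j = tt t j i.
Proof.
by have [->//|ij] := eqVneq i j; rewrite /tt (eq_sym j) (negbTE ij) t_sym.
Qed.

Lemma tt_tri i k j : tt t i j <= tt t i k + tt t k j.
Proof.
have [->|ij] := eqVneq i j; first by rewrite tt_xx addr_ge0 ?tt_ge0.
have [->|ik] := eqVneq i k; first by rewrite tt_xx add0r.
have [->|jk] := eqVneq j k; first by rewrite tt_xx addr0.
by rewrite /tt (negbTE ij) (negbTE ik) (eq_sym k) (negbTE jk) t_tri.
Qed.

Lemma tt_le_Dmax i j : tt t i j <= Dmax t.
Proof.
apply: le_trans (le_bigmax _ _ i).
exact: le_trans (le_bigmax _ (fun j => tt t i j) j).
Qed.

Lemma Dmax_le (B : R) : 0 <= B -> (forall i j, tt t i j <= B) -> Dmax t <= B.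
Proof.
move=> B0 tB; apply/bigmax_leP; split=> // i _.
by apply/bigmax_leP; split=> // j _.
Qed.

Fixpoint plen (x : 'I_n) (s : seq 'I_n) : R :=
  if s is y :: s' then tt t x y + plen y s' else 0.

Lemma plen_ge0 x s : 0 <= plen x s.
Proof. by elim: s x => //= y s IH x; rewrite addr_ge0 ?tt_ge0. Qed.

Lemma plen_cat x s1 s2 : plen x (s1 ++ s2) = plen x s1 + plen (last x s1) s2.
Proof. by elim: s1 x => [|y s1 IH] x /=; rewrite ?add0r // IH addrA. Qed.

Lemma plen_rcons x s y : plen x (rcons s y) = plen x s + tt t (last x s) y.
Proof. by rewrite -cats1 plen_cat /= addr0. Qed.

(** Skipping a point replaces two legs by a direct one, which is no longer by the triangle
    inequality. *)
Lemma plen_subseq x s1 s2 : subseq s1 s2 -> plen x s1 <= plen x s2.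
Proof.
elim: s2 s1 x => [|z s2 IH] [|y s1] x //=; first by rewrite addr_ge0 ?tt_ge0 ?plen_ge0.
case: eqP => [->|_] sub; first by rewrite lerD2l IH.
apply: (@le_trans _ _ (tt t x z + plen z (y :: s1))).
  by rewrite /= addrA lerD2r tt_tri.
by rewrite lerD2l IH.
Qed.

Lemma plen_subseq_cons x y s1 s2 :
  subseq (y :: s1) (x :: s2) -> plen y s1 <= plen x s2.
Proof.
move=> /=; case: eqP => [->|_] sub; first exact: plen_subseq.
apply: le_trans (plen_subseq x sub) => /=.
by rewrite lerDr tt_ge0.
Qed.

Lemma path_is_spanning_tree (x : 'I_n) s :
  uniq (x :: s) -> is_spanning_tree [set y in x :: s] (zip (x :: s) s).
Proof.
move=> us; split.
- by rewrite cardsE (card_uniqP us) /= size_zip /= (minn_idPr (leqnSn _)).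
(* The vertex set is generalised to any set containing the path, so that the induction can shorten
   the path while [S] stays fixed. *)
- have : forall S : {set 'I_n}, {subset x :: s <= S} ->
      all (fun e => [&& e.1 \in S, e.2 \in S & e.1 != e.2]) (zip (x :: s) s).
    move=> S; elim: s x us => //= y s IH x /andP[xs us] sS.
    rewrite !sS ?inE ?eqxx ?orbT //=.
    move: xs; rewrite inE negb_or => /andP[-> _] /=.
    by apply: IH => // z zs; apply: sS; rewrite inE zs orbT.
  by move=> H; apply: H => y ys; rewrite finset.in_set.
- have esym : connect_sym (erel (zip (x :: s) s)).
    by apply: sym_connect_sym => a b; rewrite /erel orbC.
  have xy y : y \in x :: s -> connect (erel (zip (x :: s) s)) x y.
    suff gen E : {subset zip (x :: s) s <= E} ->
        y \in x :: s -> connect (erel E) x y by exact: gen.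
    elim: s x {us esym} => [|z s IH] x /= sub; first by rewrite inE => /eqP->.
    rewrite inE => /predU1P[->//|ys].
    apply: (@connect_trans _ _ z).
      by rewrite connect1 // /erel sub ?inE ?eqxx.
    by apply: IH => // p pE; apply: sub; rewrite inE pE orbT.
  move=> y z; rewrite !inE => yS zS.
  by apply: (@connect_trans _ _ x); [rewrite esym|]; apply: xy; rewrite inE.
Qed.

Lemma tree_weight_path x s : tree_weight t (zip (x :: s) s) = plen x s.
Proof.
rewrite /tree_weight; elim: s x => [|y s IH] x /=; first by rewrite big_nil.
by rewrite big_cons /= IH.
Qed.

(** Deleting the points outside [S] and the repetitions from the route leaves a simple path through
    [S]. It is no longer than the route, and its edges form a spanning tree, which weighs at least
    as much as the minimum one. *)
Lemma mst_le_plen (S : {set 'I_n}) E x s :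
  is_mst t S E -> {subset S <= x :: s} -> tree_weight t E <= plen x s.
Proof.
move=> [[szE allE _] minE] sub.
set s' := undup [seq y <- x :: s | y \in S].
have us' : uniq s' by rewrite undup_uniq.
have ss' : subseq s' (x :: s).
  exact: subseq_trans (undup_subseq _) (filter_subseq _ _).
have memS y : (y \in s') = (y \in S).
  rewrite mem_undup mem_filter; case: (boolP (y \in S)) => //= yS.
  exact: sub.
case: s' us' ss' memS => [|y s'] us' ss' memS.
  suff -> : E = [::] by rewrite /tree_weight big_nil plen_ge0.
  case: E allE {szE minE} => //= e E /andP[/and3P[e1 _ _] _].
  by move: e1; rewrite -memS.
apply: le_trans (plen_subseq_cons ss').
rewrite -tree_weight_path; apply: minE.
have -> : S = [set z in y :: s'] by apply/setP => z; rewrite finset.in_set memS.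
exact: path_is_spanning_tree.
Qed.

Section Steps.

Variables (p : nat -> 'I_n) (a d : nat -> R).
Hypothesis a_le_d : forall k, a k <= d k.
Hypothesis aS : forall k, a k.+1 = d k + tt t (p k) (p k.+1).

(** Waiting and intermediate stops can only delay the arrival, by the triangle inequality. *)
Lemma walk_dist k l : (k < l)%N -> d k + tt t (p k) (p l) <= a l.
Proof.
elim: l => // l IH; rewrite ltnS leq_eqVlt => /predU1P[->|kl]; first by rewrite aS.
rewrite aS; apply: le_trans (lerD (le_trans (IH kl) (a_le_d l)) (lexx _)).
by rewrite -addrA lerD2l tt_tri.
Qed.

Lemma walk_le k l : (k <= l)%N -> a k <= a l.
Proof.
rewrite leq_eqVlt => /predU1P[->//|kl]; apply: le_trans (walk_dist kl).
by rewrite (le_trans (a_le_d k)) // lerDl tt_ge0.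
Qed.

Lemma plen_walk k :
  0 <= a 0%N -> plen (p 0%N) [seq p i | i <- iota 1 k] <= a k.
Proof.
move=> a0; elim: k => // k IH; rewrite -[X in iota _ X]addn1.
rewrite iotaD map_cat plen_cat /= addr0.
have -> : last (p 0%N) [seq p i | i <- iota 1 k] = p k.
  by case: k {IH} => // k; rewrite -[X in iota _ X]addn1 iotaD map_cat last_cat /= add1n.
by rewrite add1n aS lerD2r (le_trans IH).
Qed.

End Steps.

End Metric.

(** * The time of the last cut *)

Section Lastcut.

Variables (n : nat) (w : walk n) (i : 'I_n) (tau : R).
Hypothesis tau0 : 0 <= tau.

Lemma lastcut_le (B : R) :
  0 <= B -> (forall s, 0 <= s <= tau -> at_point w i s -> s <= B) ->
  lastcut w i tau <= B.
Proof.
move=> B0 cutB; apply: ge_sup; first by exists 0; split; [rewrite lexx tau0|left].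
by move=> s [s_tau [->//|/cutB]]; apply.
Qed.

Lemma le_lastcut (s : R) :
  0 <= s <= tau -> s = 0 \/ at_point w i s -> s <= lastcut w i tau.
Proof.
move=> s_tau cut; apply: ub_le_sup; last by split.
by exists tau => x [/andP[]].
Qed.

End Lastcut.

(** * Lower bounds on the height reached by an arbitrary walk *)

Section LowerBounds.

Variables (n : nat) (h : 'I_n -> R) (t : 'I_n -> 'I_n -> R).
Hypothesis h_gt0 : forall i, 0 < h i.
Hypothesis t_gt0 : forall i j, i != j -> 0 < t i j.
Hypothesis t_sym : forall i j, i != j -> t i j = t j i.
Hypothesis t_tri : forall i j k,
  i != j -> i != k -> j != k -> t i j <= t i k + t k j.
Variables (v1 : 'I_n) (w : walk n) (M : R).
Hypothesis valid_w : valid_walk t v1 w.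
Hypothesis height_le : forall i tau, 0 <= tau -> height h w i tau <= M.

Let w0 : wp w 0 = v1. Proof. by case: valid_w. Qed.
Let arr0 : warr w 0 = 0. Proof. by case: valid_w. Qed.
Let arr_le_dep : forall k, warr w k <= wdep w k. Proof. by case: valid_w. Qed.
Let arrS : forall k, warr w k.+1 = wdep w k + tt t (wp w k) (wp w k.+1).
Proof. by case: valid_w. Qed.

Let arr_ge0 k : 0 <= warr w k.
Proof. by rewrite -arr0; apply: (walk_le t_gt0 t_tri arr_le_dep arrS). Qed.

(** Without a visit, the bamboo would have grown since time 0 and exceed [M] at time [tau]. *)
Lemma first_visit i tau :
  0 <= tau -> M < h i * tau -> exists k, wp w k = i /\ warr w k <= tau.
Proof.
move=> tau0 Mlt; apply: contrapT => novisit.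
have cut0 : lastcut w i tau <= 0.
  apply: lastcut_le => // s /andP[_ s_tau] [k [wk /andP[k_s _]]].
  by case: novisit; exists k; split=> //; apply: le_trans s_tau.
have := height_le i tau0; rewrite /height leNgt => /negP; apply.
by apply: lt_le_trans Mlt _; rewrite ler_wpM2l ?(ltW (h_gt0 i)) // lerDl oppr_ge0.
Qed.

Lemma height_bound_ge0 : 0 <= M.
Proof.
apply: le_trans (height_le v1 (lexx 0)); rewrite mulr_ge0 ?(ltW (h_gt0 _)) //.
by rewrite sub0r oppr_ge0; apply: lastcut_le => // s /andP[].
Qed.

(* When the robot reaches [j], it has been away from [v1] for at least the
   travel time between the two points. *)
Lemma start_rate_dist i j : h v1 * tt t i j <= 2 * M.
Proof.
have dist1 k : h v1 * tt t v1 k <= M.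
  have [->|kv1] := eqVneq k v1; first by rewrite tt_xx mulr0 height_bound_ge0.
  (* At time [(M + 1) / h k] an uncut bamboo would have height [M + 1], so a visit to [k] must have
     occurred. *)
  have [||l [wl _]] := @first_visit k ((M + 1) / h k).
  - by rewrite divr_ge0 ?addr_ge0 ?height_bound_ge0 ?ler01 ?(ltW (h_gt0 k)).
  - by rewrite mulrC mulfVK ?gt_eqF ?h_gt0 // ltrDl ltr01.
  have dist_to m : (m < l)%N -> wp w m = v1 -> wdep w m <= warr w l - tt t v1 k.
    move=> ml wm; rewrite lerBrDr -{1}wm -wl.
    exact: (walk_dist t_gt0 t_tri arr_le_dep arrS).
  have l_gt0 : (0 < l)%N.
    by case: l wl {dist_to} => // w0k; rewrite -w0k w0 eqxx in kv1.
  apply: le_trans (height_le v1 (arr_ge0 l)).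
  rewrite /height ler_wpM2l ?(ltW (h_gt0 _)) // lerBrDr addrC -lerBrDr.
  apply: lastcut_le => //.
    by apply: le_trans (dist_to 0%N l_gt0 w0); rewrite -arr0.
  move=> s /andP[_ sl] [m [wm /andP[ms sm]]].
  (* A stay at [v1] that begins by the arrival of visit [l] has a smaller index: a later visit
     begins only after a positive travel time, and visit [l] itself is at [k]. *)
  case: (ltngtP m l) => [ml|lm|eml].
  - exact: le_trans sm (dist_to m ml wm).
  - have := walk_dist t_gt0 t_tri arr_le_dep arrS lm.
    have := arr_le_dep l; rewrite wl wm.
    have := tt_gt0 t_gt0 kv1; lra.
  - by move: kv1; rewrite -wl -wm eml eqxx.
have := tt_tri t_gt0 t_tri i v1 j.
rewrite (tt_sym t_sym i v1).
rewrite -(ler_pM2l (h_gt0 v1)) mulrDr => /le_trans; apply.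
by have := dist1 i; have := dist1 j; lra.
Qed.

Lemma start_rate_Dmax : h v1 * Dmax t <= 2 * M.
Proof.
rewrite mulrC -ler_pdivlMr //; apply: Dmax_le => [|i j].
  by rewrite divr_ge0 ?mulr_ge0 ?height_bound_ge0 ?(ltW (h_gt0 _)).
by rewrite ler_pdivlMr // mulrC start_rate_dist.
Qed.

Lemma mst_weight_le (S : {set 'I_n}) E (lo : R) :
  0 < M -> 0 < lo -> (forall j, j \in S -> lo < h j) -> is_mst t S E ->
  lo * tree_weight t E <= M.
Proof.
move=> M_gt0 lo0 loS mstE.
have [f fP] : exists f : 'I_n -> nat, forall j, j \in S ->
    wp w (f j) = j /\ warr w (f j) <= M / lo.
  suff /choice[f fP] : forall j, exists k, j \in S -> wp w k = j /\ warr w k <= M / lo.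
    by exists f.
  move=> j; case: (boolP (j \in S)) => [jS|_]; last by exists 0%N.
  have [||k kP] := @first_visit j (M / lo); last by exists k.
  - by rewrite divr_ge0 // ltW.
  - by rewrite mulrCA ltr_pMr // ltr_pdivlMr // mul1r loS.
(* The last of the chosen visits: the walk up to it passes through all of [S], and it still happens
   by time [M / lo]. *)
pose K := \max_(j in S) f j.
have arrK : warr w K <= M / lo.
  rewrite /K; elim/big_ind: _ => [|a b|j /fP[]//].
    by rewrite arr0 divr_ge0 // ltW.
  by rewrite /maxn; case: ifP.
rewrite mulrC -ler_pdivlMr //; apply: le_trans arrK.
apply: le_trans (plen_walk arr_le_dep arrS K _); last by rewrite arr0.
apply: mst_le_plen mstE _ => // j jS.
have [<- _] := fP _ jS; rewrite -[wp w 0 :: _]/[seq wp w i | i <- iota 0 K.+1].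
by apply: map_f; rewrite mem_iota add0n ltnS leq_bigmax_cond.
Qed.

End LowerBounds.

(** * Euler tours and phases *)

Lemma sum_uniq_subset (I : eqType) (F : I -> R) (A B : seq I) :
  (forall x, 0 <= F x) -> uniq A -> {subset A <= B} ->
  \sum_(x <- A) F x <= \sum_(x <- B) F x.
Proof.
move=> F0; elim: A B => [|a A IH] B /=; first by rewrite big_nil sumr_ge0.
move=> /andP[aA uA] sub.
rewrite (perm_big _ (perm_to_rem (sub _ (mem_head _ _)))) !big_cons lerD2l.
apply: IH => // x xA; apply: rem_mem; last by apply: sub; rewrite inE xA orbT.
by apply: contraNneq aA => <-.
Qed.

Section Phase.

Variables (n : nat) (t : 'I_n -> 'I_n -> R).
Hypothesis t_gt0 : forall i j, i != j -> 0 < t i j.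
Hypothesis t_sym : forall i j, i != j -> t i j = t j i.
Variables (v1 : 'I_n) (c : seq 'I_n).

Local Notation D := (Dmax t).
Local Notation cum := (cum t v1 c).
Local Notation pt k := (nth v1 c (k %% size c)).

(** This makes the distance along the tour strictly increasing, on which the termination of the
    stopping rule rests. *)
Definition moving_tour := forall k, pt k != pt k.+1.

Section Euler.

Variables (S : {set 'I_n}) (E : seq ('I_n * 'I_n)).
Hypothesis S_ge2 : (2 <= #|S|)%N.
Hypothesis treeE : is_spanning_tree S E.
Hypothesis tourc : is_euler_tour v1 S E c.

Let arcs := [seq (nth v1 c k, pt k.+1) | k <- iota 0 (size c)].

Let count_arcs u v : count_mem (u, v) arcs = erel E u v :> nat.
Proof.
move: tourc; rewrite /is_euler_tour S_ge2 => /(_ u v) <-.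
by rewrite count_map; apply: eq_count => k /=; rewrite xpair_eqE.
Qed.

Let mem_arcs u v : ((u, v) \in arcs) = erel E u v.
Proof. by rewrite -has_pred1 has_count count_arcs lt0b. Qed.

Let arc_from x : x \in S -> exists y, (x, y) \in arcs.
Proof.
move=> xS; case: treeE => _ _ conn.
have /set0Pn[y] : S :\ x != finset.set0.
  by rewrite -card_gt0; move: S_ge2; rewrite (cardsD1 x) xS.
rewrite !inE => /andP[yx yS].
have /connectP[[|z p] /=] := conn x y xS yS.
  by move=> _ eyx; rewrite eyx eqxx in yx.
by move=> /andP[+ _] _; rewrite -mem_arcs; exists z.
Qed.

(** Consecutive tour points form an arc of the tree, whose edges join distinct points; the tour is
    nonempty because a tree on at least two points has an edge. *)
Lemma euler_tour_moving : moving_tour.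
Proof.
move=> k; have [c0|c_gt0] := posnP (size c).
  have /set0Pn[x xS] : S != finset.set0 by rewrite -card_gt0 ltnW.
  by have [y] := arc_from xS; rewrite /arcs (size0nil c0).
have : (pt k, pt k.+1) \in arcs.
  apply/mapP; exists (k %% size c)%N; first by rewrite mem_iota ltn_mod.
  by rewrite -[in LHS]addn1 -modnDml addn1.
case: treeE => _ /allP allE _.
by rewrite mem_arcs => /orP[] /allE /and3P[_ _] /=; rewrite // eq_sym.
Qed.

Lemma mem_euler_tour x : x \in S -> x \in c.
Proof.
move=> xS; have [y /mapP[k]] := arc_from xS.
by rewrite mem_iota add0n => /andP[_ kc] [-> _]; rewrite mem_nth.
Qed.

(** The arcs of the tour are pairwise distinct, and each is a tree edge in one of its two
    directions, so they are contained in [E] followed by its reversal. *)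
Lemma euler_tour_length : cum 0 (size c) <= 2 * tree_weight t E.
Proof.
have -> : cum 0 (size c) = \sum_(a <- arcs) tt t a.1 a.2.
  rewrite big_map -{2}[size c]subn0 big_mkord.
  by apply: eq_bigr => k _; rewrite add0n modn_small.
pose swap (a : 'I_n * 'I_n) := (a.2, a.1).
have -> : 2 * tree_weight t E = \sum_(a <- E ++ map swap E) tt t a.1 a.2.
  rewrite big_cat big_map /= mulrDl !mul1r; congr (_ + _).
  by apply: eq_bigr => a _; rewrite tt_sym.
apply: sum_uniq_subset => [a||[u v]]; first exact: tt_ge0.
  by apply: count_mem_uniq => -[u v]; rewrite count_arcs mem_arcs.
rewrite mem_arcs mem_cat => /orP[->//|vuE]; apply/orP; right.
by apply/mapP; exists (v, u).
Qed.

End Euler.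

Lemma cumD m K1 K2 : cum m (K1 + K2) = cum m K1 + cum (m + K1) K2.
Proof.
rewrite /Defs.cum big_split_ord /=; congr (_ + _).
by apply: eq_bigr => r _; rewrite addnA.
Qed.

Lemma cum_mod m m' K : m = m' %[mod size c] -> cum m K = cum m' K.
Proof.
move=> mm'; apply: eq_bigr => r _.
have E k : (m + k = m' + k %[mod size c])%N by rewrite -modnDml mm' modnDml.
by rewrite -!addnS !E.
Qed.

Lemma cum_ge0 m K : 0 <= cum m K.
Proof. by apply: sumr_ge0 => r _; apply: tt_ge0. Qed.

Lemma cumS m K : cum m K.+1 = cum m K + tt t (pt (m + K)) (pt (m + K.+1)).
Proof. by rewrite /Defs.cum big_ord_recr /= addnS. Qed.

(** Moving the start forward by one drops the first arc of the loop and appends the same arc at its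
    end. *)
Lemma cum_loop m : cum m (size c) = cum 0 (size c).
Proof.
elim: m => // m <-; rewrite -[X in cum X _ = _]addn1.
apply: (@addrI _ (cum m 1)); rewrite -cumD addnC cumD addrC; congr (_ + _).
by apply: cum_mod; rewrite modnDr.
Qed.

Lemma cum_loops m k : cum m (k * size c) = k%:R * cum 0 (size c).
Proof.
elim: k => [|k IH]; first by rewrite mul0n mul0r /Defs.cum big_ord0.
by rewrite mulSn addnC cumD IH cum_loop mulrSr mulrDl mul1r.
Qed.

Hypothesis c_gt0 : (0 < size c)%N.
Hypothesis moving : moving_tour.
Hypothesis D_gt0 : 0 < D.

Lemma cum_gt0 m K : (0 < K)%N -> 0 < cum m K.
Proof.
case: K => // K _; rewrite cumS ltr_wpDl ?cum_ge0 // tt_gt0 // addnS.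
exact: moving.
Qed.

(** Before the last step of a phase less than [D] is covered, and one step has length at most
    [D]. *)
Lemma stopk_bounds m : D <= cum m (stopk t v1 c m) <= 2 * D.
Proof.
rewrite /stopk; case: pselect => [exK|[]]; last first.
  (* Enough full loops cover [D], so the default value of [stopk] is never taken. *)
  exists ((Num.truncn (D / cum 0 (size c))).+1 * size c)%N.
  rewrite cum_loops -ler_pdivrMr ?cum_gt0 //.
  exact/ltW/truncnS_gt.
case: ex_minnP => K -> minK /=.
case: K minK => [|K] minK; first by rewrite /Defs.cum big_ord0 mulr_ge0 ?ltW.
rewrite cumS mulrDl !mul1r lerD // ?tt_le_Dmax //.
by rewrite leNgt; apply/negP => /ltW /minK; rewrite ltnn.
Qed.

(** With fewer steps, the rest of the loop would still have positive length. *)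
Lemma cum_full m K : cum 0 (size c) <= cum m K -> (size c <= K)%N.
Proof.
move=> le_cum; rewrite leqNgt; apply/negP => K_lt.
move: le_cum; rewrite -(cum_loop m) -{1}(subnKC (ltnW K_lt)) cumD.
by apply/negP; rewrite -ltNge ltrDl cum_gt0 // subn_gt0.
Qed.

Lemma tour_position x m :
  x \in c -> exists2 r, (r < size c)%N & x = pt (m + r).
Proof.
(* The offset is [index x c - m] modulo the tour length, written so that the truncated subtraction
   loses nothing. *)
move=> xc; exists ((index x c + (size c - m %% size c)) %% size c)%N.
  by rewrite ltn_mod.
rewrite modnDmr addnCA {1}(divn_eq m (size c)) -addnA subnKC; last first.
  by rewrite ltnW // ltn_mod.
by rewrite addnC -addnA modnMDl modnDl modn_small ?index_mem // nth_index.
Qed.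

End Phase.

(** * Rounds of the algorithm *)

Section Rounds.

Variables (n : nat) (t : 'I_n -> 'I_n -> R).
Hypothesis t_gt0 : forall i j, i != j -> 0 < t i j.
Hypothesis t_tri : forall i j k,
  i != j -> i != k -> j != k -> t i j <= t i k + t k j.
Variables (v1 : 'I_n) (e : seq 'I_n) (C : nat -> seq 'I_n) (m0 : nat -> nat).

Local Notation D := (Dmax t).
Local Notation state k := (alg_state t v1 e C m0 k).
Local Notation rnd k := (alg_round t v1 e C m0 k).
Local Notation phase := (phase t v1).
Local Notation cum := (cum t v1).

Hypothesis D_gt0 : 0 < D.
Hypothesis moving : forall i, (1 <= i <= snum n)%N ->
  (2 <= size (C i))%N -> moving_tour v1 (C i).

Lemma phase_large c m : (2 <= size c)%N ->
  phase c m = ([seq nth v1 c ((m + r) %% size c) | r <- iota 0 (stopk t v1 c m).+1],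
               ((m + stopk t v1 c m) %% size c)%N).
Proof. by case: c => [|a [|b c]]. Qed.

Lemma phase_neq_nil c m : c != [::] -> (phase c m).1 != [::].
Proof. by case: c => [|a [|b c]]. Qed.

(** At most [D] for the direct trip to the last visited point, then at most [2 * D] along the
    tour. *)
Lemma plen_phase i x m : (1 <= i <= snum n)%N -> plen t x (phase (C i) m).1 <= 3 * D.
Proof.
move=> i_s; have D3 : 0 <= 3 * D by rewrite mulr_ge0 // ltW.
have [c2|] := leqP 2 (size (C i)); last first.
  case: (C i) => [|a [|b c]] //= _; rewrite addr0.
  by apply: le_trans (tt_le_Dmax t _ _) _; rewrite ler_peMl ?ltW // ltr1n.
rewrite phase_large //=; set f := fun r : nat => nth v1 (C i) ((m + r) %% size (C i)).
have /andP[_] := stopk_bounds t_gt0 (ltnW c2) (moving i_s c2) D_gt0 m.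
set K := stopk _ _ _ _ => cumK.
have : plen t (f 0%N) [seq f r | r <- iota 1 K] <= cum (C i) m K.
  apply: (@plen_walk _ _ f (cum (C i) m) (cum (C i) m)) => // [k|]; first exact: cumS.
  by rewrite /Defs.cum big_ord0.
have := tt_le_Dmax t x (f 0%N); rewrite /f; lra.
Qed.

(** Each class is handled once per round, so its phase reads the position from the start of the
    round, and the fold becomes a plain concatenation of phases. *)
Lemma roundE (st : (nat -> nat) * nat) :
  let l := flatten [seq (phase (C i) (st.1 i)).1 | i <- iota 1 (snum n)] in
  [/\ (round t v1 e C st).1 = if e is [::] then l else rcons l (nth v1 e st.2),
      forall i, (round t v1 e C st).2.1 i =
        if i \in iota 1 (snum n) then (phase (C i) (st.1 i)).2 else st.1 i
    & (round t v1 e C st).2.2 = if e is [::] then st.2 else (st.2.+1 %% size e)%N].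
Proof.
rewrite /round; set F := (fun acc i => _).
have foldF s acc : uniq s ->
    (foldl F acc s).1 = acc.1 ++ flatten [seq (phase (C i) (acc.2 i)).1 | i <- s] /\
    forall i, (foldl F acc s).2 i =
      if i \in s then (phase (C i) (acc.2 i)).2 else acc.2 i.
  elim: s acc => [|j s IH] [l mk] /=; first by rewrite cats0.
  move=> /andP[js us]; case Ej: (phase (C j) (mk j)) => [l' m'].
  have [-> mk'] := IH (l ++ l', fun x => if x == j then m' else mk x) us.
  split=> [|i] /=.
    rewrite -catA; congr (_ ++ (_ ++ flatten _)).
    by apply/eq_in_map => i si; case: eqP => // eij; rewrite -eij si in js.
  rewrite mk' inE /=; case: eqP => [->|//].
  by rewrite (negbTE js) Ej.
have [] := foldF _ ([::], st.1) (iota_uniq 1 (snum n)).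
by case: (foldl F _ _) => l mk /= -> mkE; case: e.
Qed.

Lemma plen_flatten (B : R) x ss :
  (forall s y, s \in ss -> plen t y s <= B) ->
  plen t x (flatten ss) <= (size ss)%:R * B.
Proof.
elim: ss x => [|s ss IH] x sB /=; first by rewrite mul0r.
rewrite plen_cat mulrSr mulrDl mul1r addrC lerD ?sB ?mem_head //.
by apply: IH => s' y s'_ss; apply: sB; rewrite inE s'_ss orbT.
Qed.

Lemma plen_round x k : plen t x (rnd k) <= (3 * (snum n)%:R + 1) * D.
Proof.
rewrite /alg_round; have [-> _ _] := roundE (state k); set l := flatten _.
have lB : plen t x l <= 3 * (snum n)%:R * D.
  rewrite (mulrC 3) -mulrA -(size_iota 1 (snum n))
    -(size_map (fun i => (phase (C i) ((state k).1 i)).1)).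
  apply: plen_flatten => _ y /mapP[i + ->].
  by rewrite mem_iota add1n ltnS => /plen_phase.
rewrite mulrDl mul1r.
case: e => [|a e']; first by rewrite (le_trans lB) // lerDl ltW.
by rewrite plen_rcons lerD ?tt_le_Dmax.
Qed.

Lemma mem_round i k x : (1 <= i <= snum n)%N ->
  x \in (phase (C i) ((state k).1 i)).1 -> x \in rnd k.
Proof.
move=> i_s xi; rewrite /alg_round; have [-> _ _] := roundE (state k).
set l := flatten _; have xl : x \in l.
  apply/flattenP; exists (phase (C i) ((state k).1 i)).1 => //.
  by apply: map_f; rewrite mem_iota.
by case: e => // a e'; rewrite mem_rcons inE xl orbT.
Qed.

Lemma state_counter k : (0 < size e)%N -> (state k).2 = (k %% size e)%N.
Proof.
move=> e_gt0; elim: k => [|k IH]; first by rewrite mod0n.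
rewrite [alg_state _ _ _ _ _ _]/=; have [_ _ ->] := roundE (state k).
by rewrite IH; case: e e_gt0 => // a e' _; rewrite -addn1 modnDml addn1.
Qed.

Lemma state_position i k : (1 <= i <= snum n)%N ->
  (state k.+1).1 i = (phase (C i) ((state k).1 i)).2.
Proof.
move=> i_s; rewrite [alg_state _ _ _ _ _ _]/=; have [_ -> _] := roundE (state k).
by rewrite mem_iota add1n ltnS i_s.
Qed.

Definition visited_every (G : nat) (x : 'I_n) :=
  forall k, exists2 j, (j < G)%N & x \in rnd (k + j).

Lemma visited_V0 x : x \in e -> visited_every (size e) x.
Proof.
move=> xe k; have e_gt0 : (0 < size e)%N by case: e xe.
(* The counter in round [k] is [k %% size e]; this is the number of rounds until it equals
   [index x e]. *)
exists ((index x e + (size e - k %% size e)) %% size e)%N; first by rewrite ltn_mod.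
set j := (_ %% _)%N; rewrite /alg_round; have [-> _ _] := roundE (state (k + j)).
rewrite state_counter //.
have -> : ((k + j) %% size e = index x e)%N.
  rewrite /j modnDmr addnCA {1}(divn_eq k (size e)) -addnA subnKC; last first.
    by rewrite ltnW // ltn_mod.
  by rewrite addnC -addnA modnMDl modnDl modn_small ?index_mem.
by rewrite nth_index //; case: e xe => // a e' _; rewrite mem_rcons mem_head.
Qed.

(** The position on a one-point tour never changes, and its initial value 0 makes [nth] return [x]
    rather than the default. *)
Lemma visited_single i x :
  (1 <= i <= snum n)%N -> C i = [:: x] -> m0 i = 0%N -> visited_every 1 x.
Proof.
move=> i_s Ci mi k; exists 0%N => //; rewrite addn0; apply: (mem_round i_s).
have -> : (state k).1 i = 0%N.
  by elim: k => // k IH; rewrite state_position // IH Ci.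
by rewrite Ci /= mem_head.
Qed.

(** Each phase resumes where the previous one on the same tour stopped, so [q] phases join into one
    uninterrupted stretch of [K] steps, each phase adding at least [D]. Positions agree only modulo
    the tour length. *)
Lemma rounds_cover i k q :
  (1 <= i <= snum n)%N -> (2 <= size (C i))%N ->
  exists K, [/\ q%:R * D <= cum (C i) ((state k).1 i) K,
    (state (k + q)).1 i = (state k).1 i + K %[mod size (C i)] &
    forall r, (r < K)%N -> exists2 j, (j < q)%N &
      nth v1 (C i) (((state k).1 i + r) %% size (C i)) \in rnd (k + j)].
Proof.
move=> i_s c2; elim: q => [|q [K [cumK posK visK]]].
  by exists 0%N; rewrite mul0r cum_ge0 // addn0 addn0.
set m := (state k).1 i in cumK posK visK *; set m' := (state (k + q)).1 i in posK.
have /andP[stop_ge _] := stopk_bounds t_gt0 (ltnW c2) (moving i_s c2) D_gt0 m'.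
exists (K + stopk t v1 (C i) m')%N; split.
- by rewrite mulrSr mulrDl mul1r cumD lerD // -(cum_mod t v1 _ posK).
- rewrite addnS state_position // -/m' phase_large //= modn_mod.
  by rewrite addnA -modnDml posK modnDml.
- move=> r rlt; have [rK|Kr] := ltnP r K.
    by have [j jq jv] := visK r rK; exists j; rewrite // ltnS ltnW.
  exists q => //; apply: (mem_round i_s); rewrite -/m' phase_large //.
  apply/mapP; exists (r - K)%N.
    by rewrite mem_iota /= ltnS leq_subLR ltnW.
  by rewrite -[in RHS]modnDml posK modnDml -addnA subnKC.
Qed.

(** In [q] rounds the robot advances by at least [q%:R * D], hence by a full loop, which passes
    every position. *)
Lemma visited_tour i q x :
  (1 <= i <= snum n)%N -> (2 <= size (C i))%N -> x \in C i ->
  cum (C i) 0 (size (C i)) <= q%:R * D -> visited_every q x.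
Proof.
move=> i_s c2 xC le_q k; have [K [cumK _ visK]] := rounds_cover k q i_s c2.
have [r rC ->] := tour_position v1 (ltnW c2) ((state k).1 i) xC.
apply: visK; apply: leq_trans rC _.
exact: (cum_full t_gt0 (moving i_s c2) (le_trans le_q cumK)).
Qed.

(** * Timing of the algorithm *)

Local Notation A := (alg_walk t v1 e C m0).
Local Notation visits K := (flatten (mkseq (alg_round t v1 e C m0) K)).

Hypothesis rnd_neq_nil : forall k, rnd k != [::].

Let visitsS K : visits K.+1 = visits K ++ rnd K.
Proof. by rewrite /mkseq -addn1 iotaD map_cat flatten_cat /= cats0. Qed.

Let visits_prefix K K' : (K <= K')%N -> exists s, visits K' = visits K ++ s.
Proof.
move=> /subnKC <-; elim: (K' - K)%N => [|d [s IH]].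
  by exists [::]; rewrite addn0 cats0.
by rewrite addnS visitsS IH -catA; eexists.
Qed.

Let leq_size_visits K : (K <= size (visits K))%N.
Proof.
elim: K => // K IH; rewrite visitsS size_cat -addn1 leq_add //.
by rewrite lt0n size_eq0.
Qed.

Let size_visits_le K K' : (K <= K')%N -> (size (visits K) <= size (visits K'))%N.
Proof. by move=> /visits_prefix[s ->]; rewrite size_cat leq_addr. Qed.

(** [alg_point N] is read off the first [N.+1] rounds. No round is empty, so these contain position
    [N], and any other sufficiently long prefix of rounds agrees there. *)
Lemma alg_pointE K N : (N <= size (visits K))%N -> wp A N = nth v1 (v1 :: visits K) N.
Proof.
case: N => // N NK; change (nth v1 (visits N.+2) N = nth v1 (visits K) N).
have NN := leq_size_visits N.+2.
have nth_prefix s s' : (N < size s)%N -> nth v1 s N = nth v1 (s ++ s') N.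
  by rewrite nth_cat => ->.
have [le|/ltnW le] := leqP K N.+2.
  by have [s ->] := visits_prefix le; rewrite -nth_prefix.
by have [s ->] := visits_prefix le; rewrite -nth_prefix // ltnW.
Qed.

Lemma alg_timeE K N : (N <= size (visits K))%N ->
  warr A N = plen t v1 (take N (visits K)).
Proof.
elim: N => [|N IH] NK; first by rewrite take0.
rewrite (take_nth v1) // plen_rcons -IH 1?ltnW //=; congr (_ + tt _ _ _).
  rewrite -[LHS]/(wp A N) (alg_pointE (ltnW NK)) (last_nth v1) size_takel 1?ltnW //.
  by case: N {IH NK} => //= N; rewrite nth_take.
by rewrite -[LHS]/(wp A N.+1) (alg_pointE NK).
Qed.

(** The walk begins with an extra [v1], so index [size (visits K)] is the last point of the first
    [K] rounds. *)
Definition round_end (K : nat) : R := warr A (size (visits K)).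

Let stepA k : warr A k.+1 = wdep A k + tt t (wp A k) (wp A k.+1).
Proof. by []. Qed.

Let arr_le_depA k : warr A k <= wdep A k.
Proof. by []. Qed.

Let warr_le k l : (k <= l)%N -> warr A k <= warr A l.
Proof. exact: (walk_le t_gt0 t_tri arr_le_depA stepA). Qed.

Lemma round_end0 : round_end 0 = 0.
Proof. by []. Qed.

Lemma round_endS K : round_end K.+1 <= round_end K + (3 * (snum n)%:R + 1) * D.
Proof.
rewrite /round_end !(@alg_timeE K.+1) // ?size_visits_le // take_size.
by rewrite visitsS plen_cat take_size_cat // lerD2l plen_round.
Qed.

Lemma round_endD K d :
  round_end (K + d) <= round_end K + d%:R * ((3 * (snum n)%:R + 1) * D).
Proof.
elim: d => [|d IH]; first by rewrite addn0 mul0r addr0.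
rewrite addnS mulrSr mulrDl mul1r addrA.
by apply: le_trans (round_endS _) _; rewrite lerD2r.
Qed.

Lemma round_visit x K : x \in rnd K -> exists2 N,
  (size (visits K) < N <= size (visits K.+1))%N & wp A N = x.
Proof.
move=> xK; exists (size (visits K) + (index x (rnd K)).+1)%N.
  by rewrite addnS ltnS leq_addr visitsS size_cat -addnS leq_add2l index_mem.
rewrite (@alg_pointE K.+1); last by rewrite visitsS size_cat leq_add2l index_mem.
by rewrite addnS visitsS /= nth_cat ltnNge leq_addr /= addKn nth_index.
Qed.

(** Any [G + G'] consecutive rounds contain a visit to [x] followed by one to [y], hence last at
    least the fixed positive time [tt t x y]. So every time [tau] falls into some round. *)
Lemma round_end_unbounded x y G G' : x != y ->
  visited_every G x -> visited_every G' y -> forall tau, exists K, tau < round_end K.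
Proof.
move=> xy visx visy tau.
have step K : round_end K + tt t x y <= round_end (K + (G + G'))%N.
  have [j jG /round_visit[N /andP[KN NK] Nx]] := visx K.
  have [j' jG' /round_visit[N' /andP[KN' NK'] Ny]] := visy (K + G)%N.
  have NN' : (N < N')%N.
    by apply: leq_ltn_trans NK (leq_ltn_trans _ KN'); apply: size_visits_le; lia.
  have := walk_dist t_gt0 t_tri arr_le_depA stepA NN'; rewrite Nx Ny.
  have : round_end K <= warr A N.
    by apply: warr_le; apply: leq_trans (ltnW KN); apply: size_visits_le; lia.
  have : warr A N' <= round_end (K + (G + G')).
    by apply: warr_le; apply: leq_trans NK' _; apply: size_visits_le; lia.
  by rewrite -[wdep A N]/(warr A N); lra.
have steps k : k%:R * tt t x y <= round_end (k * (G + G')).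
  elim: k => [|k IH]; first by rewrite mul0r.
  rewrite mulrSr mulrDl mul1r mulSn addnC.
  by apply: le_trans (step _); rewrite lerD2r.
exists ((Num.truncn (tau / tt t x y)).+1 * (G + G'))%N.
apply: lt_le_trans (steps _); rewrite -ltr_pdivrMr ?(tt_gt0 t_gt0) //.
exact: truncnS_gt.
Qed.

Lemma height_visited_every (h : 'I_n -> R) G x tau :
  0 <= h x -> (forall s, exists K, s < round_end K) -> visited_every G x -> 0 <= tau ->
  height h A x tau <= h x * (G.+1%:R * ((3 * (snum n)%:R + 1) * D)).
Proof.
move=> hx unb visx tau0; rewrite /height ler_wpM2l //.
(* By minimality [tau] lies in the round following the first [K] ones, where [K' = K.+1]. *)
have [K' ltK' minK] := ex_minnP (unb tau).
case: K' ltK' minK => [|K] ltK minK; first by move: ltK; rewrite round_end0 ltNge tau0.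
have leK : round_end K <= tau by rewrite leNgt; apply/negP => /minK; rewrite ltnn.
set rho := (3 * _ + 1) * D.
have rho0 : 0 <= rho by rewrite mulr_ge0 ?addr_ge0 ?mulr_ge0 ?ler0n // ltW.
(* Either at most [G] rounds have begun since time 0, or one of the [G] rounds completed last
   contains a cut; both ways the growth lasts at most [G.+1] rounds. *)
have [KG|GK] := ltnP K G.
  have : tau <= G.+1%:R * rho.
    apply: ltW (lt_le_trans ltK _); have := round_endD 0 K.+1.
    rewrite round_end0 add0r add0n => /le_trans; apply.
    by rewrite ler_wpM2r // ler_nat ltnS ltnW.
  have : 0 <= lastcut A x tau by apply: le_lastcut; [rewrite lexx|left].
  by lra.
have [j jG /round_visit[N /andP[KN NK] Nx]] := visx (K - G)%N.
have cut : warr A N <= lastcut A x tau.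
  apply: le_lastcut; last by right; exists N; rewrite Nx !lexx.
  apply/andP; split; first by rewrite -round_end0; apply: warr_le.
  apply: le_trans leK; apply: warr_le; apply: leq_trans NK _.
  by apply: size_visits_le; lia.
have : round_end (K - G) <= warr A N.
  by apply: warr_le; apply: leq_trans (ltnW KN); apply: size_visits_le; lia.
have := round_endD (K - G) G.+1; rewrite addnS subnK //.
by move: ltK cut; rewrite -/rho; lra.
Qed.

End Rounds.

(** * The approximation ratio *)

(** Rounding up gives [s - 1 <= 2 log_2 n], and [1 <= log_2 n] absorbs the remaining unit. *)
Lemma snum_le n : (1 < n)%N -> (snum n)%:R <= 3 * (ln (n%:R : R) / ln 2).
Proof.
move=> n1; have ln2 : 0 < ln 2 :> R by rewrite ln_gt0 ?ltr1n.
have n2_gt1 : (1 < n ^ 2)%N by rewrite -(exp1n 2) ltn_exp2r.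
have up_lt : (2 ^ (snum n).-1 < n ^ 2)%N by rewrite up_log_gtn.
have snum_gt0 : (0 < snum n)%N by rewrite up_log_gt0.
have pos m : (0 < m)%N -> (m%:R : R) \is Num.pos by rewrite posrE ltr0n.
have : ((snum n).-1)%:R * ln 2 <= 2 * ln n%:R :> R.
  rewrite !mulr_natl -!lnXn ?ltr0n // 1?ltnW //.
  rewrite ler_ln ?posrE ?exprn_gt0 ?ltr0n // 1?ltnW //.
  by rewrite -!natrX ler_nat ltnW.
have : ln 2 <= ln n%:R :> R by rewrite ler_ln ?posrE ?ltr0n ?ler_nat // ltnW.
rewrite -[in X in _ -> _ -> X](prednK snum_gt0) mulrA ler_pdivlMr // mulrSr; lra.
Qed.

Section Instance.

Variables (n : nat) (Hn : (1 < n)%N) (h : 'I_n -> R) (t : 'I_n -> 'I_n -> R).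
Hypothesis h_gt0 : forall i, 0 < h i.
Hypothesis h_dec : forall i j : 'I_n, (i <= j)%N -> h j <= h i.
Hypothesis h_sum : \sum_(i < n) h i = 1.
Hypothesis t_gt0 : forall i j, i != j -> 0 < t i j.
Hypothesis t_sym : forall i j, i != j -> t i j = t j i.
Hypothesis t_tri : forall i j k,
  i != j -> i != k -> j != k -> t i j <= t i k + t k j.
Variables (e : seq 'I_n) (E : nat -> seq ('I_n * 'I_n)) (C : nat -> seq 'I_n)
  (m0 : nat -> nat).
Hypothesis e_uniq : uniq e.
Hypothesis mem_e : forall j, (j \in e) = inV h 0 j.
Hypothesis mstE : forall i, (1 <= i <= snum n)%N -> is_mst t (Vset h i) (E i).
Hypothesis tourC : forall i, (1 <= i <= snum n)%N ->
  is_euler_tour (v1_of Hn) (Vset h i) (E i) (C i).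
Hypothesis m0_lt : forall i, (1 <= i <= snum n)%N ->
  C i != [::] -> (m0 i < size (C i))%N.

Local Notation v1 := (v1_of Hn).
Local Notation D := (Dmax t).
Local Notation A := (alg_walk t v1 e C m0).

Let n_gt0 : 0 < n%:R :> R. Proof. by rewrite ltr0n ltnW. Qed.

Lemma distinct_points : v1 != Ordinal Hn.
Proof. by []. Qed.

Lemma Dmax_gt0 : 0 < D.
Proof. exact: lt_le_trans (tt_gt0 t_gt0 distinct_points) (tt_le_Dmax _ _ _). Qed.

Lemma h_le_start i : h i <= h v1.
Proof. exact: h_dec. Qed.

Lemma h_le1 i : h i <= 1.
Proof. by rewrite -h_sum (bigD1 i) //= lerDl sumr_ge0 // => j _; apply: ltW. Qed.

(** The largest rate is at least the average rate. *)
Lemma start_ge : n%:R^-1 <= h v1.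
Proof.
rewrite -div1r ler_pdivrMr // mulr_natr -h_sum -[X in _ *+ X]card_ord -sumr_const.
by apply: ler_sum => i _; apply: h_le_start.
Qed.

(** The class is the least [i] with [h j <= 2^i / n^2]. It is at most [snum n] because rates are at
    most 1, and minimality gives the lower end of the class. *)
Lemma class_exists j : (n%:R ^+ 2)^-1 < h j ->
  exists2 i, (1 <= i <= snum n)%N & j \in Vset h i.
Proof.
move=> hj; have n2_gt0 : 0 < n%:R ^+ 2 :> R by rewrite exprn_gt0.
pose P i := h j <= 2%:R ^+ i / n%:R ^+ 2.
have Psnum : P (snum n).
  apply: le_trans (h_le1 j) _; rewrite ler_pdivlMr // mul1r -!natrX ler_nat.
  exact: up_logP.
have [[|i] Pi minP] := ex_minnP (ex_intro P _ Psnum).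
  by move: Pi; rewrite /P expr0 mul1r leNgt hj.
exists i.+1; first by rewrite /= minP.
rewrite inE /inV /= [X in _ && X]Pi andbT ltNge.
by apply/negP => /minP; rewrite ltnn.
Qed.

Lemma tour_small i : (1 <= i <= snum n)%N ->
  (#|Vset h i| <= 1)%N -> C i = enum (Vset h i).
Proof.
by move=> i_s V1; have := tourC i_s; rewrite /is_euler_tour leqNgt ltnS V1.
Qed.

Lemma tour_moving i : (1 <= i <= snum n)%N ->
  (2 <= size (C i))%N -> moving_tour v1 (C i).
Proof.
move=> i_s; have [V2 _|V1] := leqP 2 #|Vset h i|.
  by have [tree _] := mstE i_s; exact: (euler_tour_moving V2 tree (tourC i_s)).
by rewrite tour_small // -cardE leqNgt V1.
Qed.

Lemma mem_tour i x : (1 <= i <= snum n)%N -> x \in Vset h i -> x \in C i.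
Proof.
move=> i_s xV; have [V2|V1] := leqP 2 #|Vset h i|.
  by have [tree _] := mstE i_s; exact: (mem_euler_tour V2 tree (tourC i_s) xV).
by rewrite tour_small // mem_enum.
Qed.

(** Since [h v1 >= 1/n > 1/n^2], the point [v1] lies in a class of positive index, and the phase on
    its tour lists at least one point. *)
Lemma round_neq_nil k : alg_round t v1 e C m0 k != [::].
Proof.
have [|i i_s v1V] := @class_exists v1.
  apply: lt_le_trans start_ge; rewrite ltf_pV2 ?posrE ?exprn_gt0 //.
  by rewrite expr2 ltr_pMr // ltr1n.
have := phase_neq_nil t v1 ((alg_state t v1 e C m0 k).1 i) (c := C i).
case Eph: (phase _ _ _ _).1 => [|x l].
  by move=> /(_ _)/negP; case=> //; move: (mem_tour i_s v1V); case: (C i).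
move=> _; have := @mem_round n t v1 e C m0 i k x i_s; rewrite Eph mem_head => /(_ isT).
by case: alg_round.
Qed.

(* [G] rounds take time [O(G * D * log n)], so the bound on
   [h x * (G.+1 * D)] is the approximation ratio up to the factor [log n]. *)
Lemma visit_gap x : exists2 G, visited_every t v1 e C m0 G x &
  forall (w : walk n) (M : R), valid_walk t v1 w ->
    (forall i tau, 0 <= tau -> height h w i tau <= M) ->
    h x * (G.+1%:R * D) <= 8 * M.
Proof.
have D0 := Dmax_gt0.
have [V0|/class_exists[i i_s xV]] := leP (h x) (n%:R ^+ 2)^-1.
  have xe : x \in e by rewrite mem_e.
  exists (size e); first exact: visited_V0.
  move=> w M valid_w height_le.
  have := start_rate_Dmax h_gt0 t_gt0 t_sym t_tri valid_w height_le.
  have M0 := height_bound_ge0 h_gt0 v1 height_le.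
  (* With [h x <= 1/n^2] this gives [h x * (size e).+1%:R <= 2/n <= 2 * h v1], so the height is
     compared with [h v1 * D]. *)
  have size_e : (size e).+1%:R <= 2 * n%:R :> R.
    rewrite -natrM ler_nat mul2n -addnn -addn1 leq_add ?(ltnW Hn) //.
    by rewrite -(card_uniqP e_uniq) -[X in (_ <= X)%N]card_ord; apply: max_card.
  suff : h x * (size e).+1%:R * D <= 2 * h v1 * D by lra.
  rewrite ler_pM2r //; apply: le_trans (ler_pM _ _ V0 size_e) _ => //; first exact: ltW.
  have := start_ge; rewrite -(ler_pM2l (ltr0Sn R 1)); apply: le_trans.
  by rewrite mulrCA expr2 invfM mulfVK ?gt_eqF.
have [V2|V1] := leqP 2 #|Vset h i|; last first.
  have Ci := tour_small i_s V1; have xC := mem_tour i_s xV.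
  have szC : size (C i) = 1%N.
    by apply/eqP; rewrite eqn_leq {1}Ci -cardE -ltnS V1; case: (C i) xC.
  have Cx : C i = [:: x].
    by case: (C i) szC xC => [|y [|]] // _; rewrite inE => /eqP->.
  exists 1%N.
    apply: (visited_single _ _ _ i_s Cx).
    by have := m0_lt i_s; rewrite Cx ltnS leqn0 => /(_ isT)/eqP.
  move=> w M valid_w height_le.
  have := start_rate_Dmax h_gt0 t_gt0 t_sym t_tri valid_w height_le.
  have M0 := height_bound_ge0 h_gt0 v1 height_le.
  have : h x * D <= h v1 * D by rewrite ler_pM2r // h_le_start.
  lra.
have [tree _] := mstE i_s; have xC := mem_tour i_s xV.
have C2 : (2 <= size (C i))%N.
  apply: leq_trans V2 (leq_trans _ (card_size _)); apply: subset_leq_card.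
  by apply/fintype.subsetP => y; apply: mem_tour.
set L := cum t v1 (C i) 0 (size (C i)).
have L0 : 0 <= L by apply: cum_ge0.
(* The least integer above [L / D]: so many advances of [D] cover the whole tour. *)
exists (Num.truncn (L / D)).+1.
  apply: (visited_tour t_gt0 e m0 Dmax_gt0 tour_moving i_s C2 xC).
  by rewrite -ler_pdivrMr // ltW // truncnS_gt.
move=> w M valid_w height_le.
have hD := start_rate_Dmax h_gt0 t_gt0 t_sym t_tri valid_w height_le.
have GD : (Num.truncn (L / D)).+2%:R * D <= L + 2 * D.
  have : (Num.truncn (L / D))%:R * D <= L.
    by rewrite -ler_pdivlMr // truncn_le divr_ge0 // ltW.
  by rewrite !mulrSr; lra.
set lo : R := 2%:R ^+ i.-1 / n%:R ^+ 2.
have lo0 : 0 < lo by rewrite divr_gt0 ?exprn_gt0.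
have V_lo j : j \in Vset h i -> lo < h j.
  by rewrite /lo; case: (i) i_s => // i' _; rewrite inE /inV /= => /andP[].
have M0 : 0 < M by have := mulr_gt0 (h_gt0 v1) D0; lra.
have W := mst_weight_le h_gt0 t_gt0 t_tri valid_w height_le M0 lo0 V_lo (mstE i_s).
have LW : lo * L <= 2 * M.
  apply: le_trans (_ : lo * (2 * tree_weight t (E i)) <= _); last by lra.
  by rewrite ler_pM2l //; apply: (euler_tour_length t_gt0 t_sym V2 (tourC i_s)).
have hx2 : h x <= 2 * lo.
  move: xV; rewrite /lo; case: (i) i_s => // i' _; rewrite inE /inV /= => /andP[_].
  by rewrite exprS -mulrA.
(* The constant 8 arises here: [h x * L <= 2 * lo * L <= 4 * M], and
   [2 * h x * D <= 2 * h v1 * D <= 4 * M]. *)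
have : h x * D <= h v1 * D by rewrite ler_pM2r // h_le_start.
have : h x * ((Num.truncn (L / D)).+2%:R * D) <= h x * (L + 2 * D).
  by rewrite ler_wpM2l // ltW.
have : h x * L <= 2 * lo * L by rewrite ler_wpM2r.
lra.
Qed.

Lemma alg_height_le (w : walk n) (M : R) i tau : valid_walk t v1 w ->
  (forall i tau, 0 <= tau -> height h w i tau <= M) -> 0 <= tau ->
  height h A i tau <= 80 * (ln (n%:R) / ln 2) * M.
Proof.
move=> valid_w height_le tau0.
have M0 := height_bound_ge0 h_gt0 v1 height_le.
have [G visG /(_ w M valid_w height_le) hG] := visit_gap i.
have unb s : exists K, s < round_end t v1 e C m0 K.
  have [Gx visx _] := visit_gap v1; have [Gy visy _] := visit_gap (Ordinal Hn).
  exact: (round_end_unbounded t_gt0 t_tri Dmax_gt0 round_neq_nil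
    distinct_points visx visy).
apply: le_trans (height_visited_every t_gt0 t_tri Dmax_gt0 tour_moving
  round_neq_nil (ltW (h_gt0 i)) unb visG tau0) _.
have log1 : 1 <= ln (n%:R : R) / ln 2.
  rewrite ler_pdivlMr ?mul1r ?ln_gt0 ?ltr1n //.
  by rewrite ler_ln ?posrE ?ltr0n ?ler_nat // ltnW.
have := snum_le Hn; set l := ln _ / _ in log1 *; set s := (snum n)%:R => sl.
(* From [s <= 3 * l] and [1 <= l] one gets [3 * s + 1 <= 10 * l]; with the factor 8 this yields
   80. *)
have : (3 * s + 1) * (h i * (G.+1%:R * D)) <= (10 * l) * (8 * M).
  apply: ler_pM => //; first by rewrite addr_ge0 ?mulr_ge0 ?ler0n.
    by rewrite !mulr_ge0 // ltW ?Dmax_gt0.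
  lra.
lra.
Qed.

End Instance.

Theorem theorem6 :
  exists c : R, 0 < c /\
  forall (n : nat) (Hn : (1 < n)%N) (h : 'I_n -> R) (t : 'I_n -> 'I_n -> R),
    (forall i, 0 < h i) ->
    (forall i j : 'I_n, (i <= j)%N -> h j <= h i) ->
    \sum_(i < n) h i = 1 ->
    (forall i j, i != j -> 0 < t i j) ->
    (forall i j, i != j -> t i j = t j i) ->
    (forall i j k, i != j -> i != k -> j != k -> t i j <= t i k + t k j) ->
    forall (e : seq 'I_n) (E : nat -> seq ('I_n * 'I_n)) (C : nat -> seq 'I_n)
           (m0 : nat -> nat),
    uniq e ->
    (forall j, (j \in e) = inV h 0 j) ->
    (forall i, (1 <= i <= snum n)%N -> is_mst t (Vset h i) (E i)) ->
    (forall i, (1 <= i <= snum n)%N ->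
       is_euler_tour (v1_of Hn) (Vset h i) (E i) (C i)) ->
    (forall i, (1 <= i <= snum n)%N -> C i != [::] -> (m0 i < size (C i))%N) ->
    (MH h (alg_walk t (v1_of Hn) e C m0)
       <= ((c * (ln (n%:R) / ln 2))%:E * OPT h t (v1_of Hn))%E)%E.
Proof.
exists 80; split; first by rewrite ltr0n.
move=> n Hn h t h_gt0 h_dec h_sum t_gt0 t_sym t_tri e E C m0.
move=> e_uniq mem_e mstE tourC m0_lt.
set c := 80 * _; have c0 : 0 < c.
  by rewrite mulr_gt0 ?divr_gt0 ?ln_gt0 ?ltr1n ?ltr0n.
(* Dividing by the positive factor [c] reduces the bound on the infimum to a bound for each single
   walk. *)
rewrite -lee_pdivrMl //; apply: le_ereal_inf_tmp => _ [w valid_w <-].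
rewrite lee_pdivrMl //.
have ge_MH i tau : 0 <= tau -> ((height h w i tau)%:E <= MH h w)%E.
  by move=> tau0; apply: ereal_sup_ubound; exists i, tau.
case EM: (MH h w) ge_MH => [M| |] ge_MH.
- apply: ge_ereal_sup => _ [i [tau [tau0 ->]]]; rewrite -EFinM lee_fin.
  apply: (alg_height_le h_gt0 h_dec h_sum t_gt0 t_sym t_tri e_uniq mem_e mstE
    tourC m0_lt i valid_w _ tau0).
  by move=> j s s0; rewrite -lee_fin ge_MH.
- by rewrite gt0_muley ?lte_fin // leey.
(* The supremum cannot be minus infinity, since it is at least the real height of [v1] at time 0. *)
- by have := ge_MH (v1_of Hn) 0 (lexx 0); rewrite leeNy_eq.
Qed.
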